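(* Let $f,g,k_x,k_y$ satisfy the plant assumption, let $\Phi=\Phi_u+\Phi_y$ and $\mathcal U$ satisfy the cost assumption, and let the plant be monotone with respect to the standard orders ($\mathcal K_U=\mathbb R^m_{\ge0}$, $\mathcal K_X=\mathbb R^n_{\ge0}$, $\mathcal K_Y=\mathbb R^p_{\ge0}$), all as described in the context. Define $$\tilde\Psi(u,\bar u):=\Phi_u(u)+k_y(u)^\top\nabla\Phi_y(k_y(\bar u)).$$ Assume that there are constants $\mu>\ell\ge 0$ such that $\tilde\Psi(u,\bar u)$ is $\mu$-strongly convex in $u$ for any $\bar u\in\mathcal U$, and the map $\nabla_u\tilde\Psi(u,\bar u)$ is $\ell$-Lipschitz in $\bar u\in\mathcal U$ for every fixed $u\in\mathcal U$. Then there is a unique $u^\star\in\mathcal U$ such that, for every $u_0\in\mathcal U$, the iteration $$u_{j+1}=\operatorname*{argmin}_{u\in\mathcal U}\ \Phi_u(u)+k_y(u)^\top\nabla\Phi_y(k_y(u_j)),\qquad j=0,1,2,\dots$$ converges to $u^\star$.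
   Context: **Notation.** For differentiable $h:\mathbb R^a\to\mathbb R^b$, $\nabla h(x)\in\mathbb R^{b\times a}$ is the Jacobian; for scalar $h$, $\nabla h(x)$ also denotes the gradient (column vector); $\nabla_u$ is the gradient with respect to the variable $u$. Norms are Euclidean. Solutions of differential equations are in the Carathéodory sense. **Orders.** An orthant $\mathcal K\subset\mathbb R^n$ induces the partial order $x\succcurlyeq_{\mathcal K}y\iff x-y\in\mathcal K$; $\mathbb R^n_{\ge0}$ gives the standard (elementwise) order. **Monotone system.** A system $\dot x=f(x,u)$, $y=g(x)$ is monotone with respect to orthants $\mathcal K_U,\mathcal K_X,\mathcal K_Y$ (in input, state and output space) if (1) for any two measurable, locally bounded inputs with $u(t)\succcurlyeq_{\mathcal K_U}u'(t)$ for almost all $t$ and any initial conditions $x_0\succcurlyeq_{\mathcal K_X}x_0'$, the corresponding solutions (assumed well defined) satisfy $x(t,x_0,u)\succcurlyeq_{\mathcal K_X}x(t,x_0',u')$ for all $t\ge 0$; and (2) $x\succcurlyeq_{\mathcal K_X}x'$ implies $g(x)\succcurlyeq_{\mathcal K_Y}g(x')$. **Plant assumption.** The plant is $\dot x=f(x,u)$, $y=g(x)$ with $f:\mathbb R^n\times\mathbb R^m\to\mathbb R^n$ and $g:\mathbb R^n\to\mathbb R^p$ locally Lipschitz. There is a continuous steady-state map $k_x:\mathbb R^m\to\mathbb R^n$: for every constant input $\bar u\in\mathbb R^m$ and every initial condition, the solution of the plant converges to $k_x(\bar u)$ as $t\to\infty$. The steady-state output map is $k_y:=g\circ k_x:\mathbb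 R^m\to\mathbb R^p$; it is continuously differentiable and $\nabla k_y:\mathbb R^m\to\mathbb R^{p\times m}$ is locally Lipschitz. **Cost assumption.** $\Phi(u,y)=\Phi_u(u)+\Phi_y(y)$ with $\Phi:\mathbb R^m\times\mathbb R^p\to\mathbb R$ continuously differentiable and $\nabla\Phi$ locally Lipschitz. The set $\mathcal U=[u_1^{\min},u_1^{\max}]\times\dots\times[u_m^{\min},u_m^{\max}]\subset\mathbb R^m$ is a compact box. *)

(* Defs.v *)
(* Elements of R^n are row vectors.  The library norm on matrices is the max
   norm, which induces the Euclidean topology; all quantitative bounds below
   use the Euclidean norm [enorm]. *)
From mathcomp Require Import all_boot all_order all_algebra.
From mathcomp Require Import all_classical all_reals all_analysis.

Set Implicit Arguments.
Unset Strict Implicit.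
Unset Printing Implicit Defensive.

Import Order.TTheory GRing.Theory Num.Theory.
Import numFieldNormedType.Exports.

Local Open Scope classical_set_scope.
Local Open Scope ring_scope.

Definition dotv (R : realType) (n : nat) (x y : 'rV[R]_n) : R :=
  \sum_(i < n) x 0 i * y 0 i.

(* On matrices with more than one row this is the Frobenius norm. *)
Definition enorm (R : realType) (a b : nat) (A : 'M[R]_(a, b)) : R :=
  Num.sqrt (\sum_(i < a) \sum_(j < b) A i j ^+ 2).

Definition joint (R : realType) (a b : nat) (T : Type)
    (h : 'rV[R]_a -> 'rV[R]_b -> T) (z : 'rV[R]_(a + b)) : T :=
  h (lsubmx z) (rsubmx z).

Definition locally_lipschitz (R : realType) (a b c : nat)
    (h : 'rV[R]_a -> 'M[R]_(b, c)) : Prop :=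
  forall x : 'rV[R]_a, exists2 V : set 'rV[R]_a, nbhs x V &
    exists k : R, forall y z, V y -> V z ->
      enorm (h y - h z) <= k * enorm (y - z).

Definition grad (R : realType) (n : nat) (h : 'rV[R]_n -> R) (x : 'rV[R]_n) :
    'rV[R]_n :=
  \row_(i < n) 'D_(delta_mx 0 i) h x.

(* The library's ['J h x] acts on row vectors by right multiplication, so it
   is the transpose of the usual Jacobian. *)
Definition Jac (R : realType) (a b : nat) (h : 'rV[R]_a -> 'rV[R]_b)
    (x : 'rV[R]_a) : 'M[R]_(b, a) :=
  ('J h x)^T.

Definition C1_scalar (R : realType) (n : nat) (h : 'rV[R]_n -> R) : Prop :=
  (forall x, differentiable h x) /\ continuous (grad h).

Definition C1_vector (R : realType) (a b : nat)
    (h : 'rV[R]_a -> 'rV[R]_b) : Prop :=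
  (forall x, differentiable h x) /\ continuous (Jac h).

Definition abs_continuous (R : realType) (n : nat) (T : R)
    (x : R -> 'rV[R]_n) : Prop :=
  forall e : R, 0 < e -> exists2 d : R, 0 < d &
    forall (k : nat) (a b : 'I_k -> R),
      (forall i, 0 <= a i /\ a i <= b i /\ b i <= T) ->
      trivIset [set: 'I_k] (fun i => `]a i, b i[%classic) ->
      \sum_(i < k) (b i - a i) < d ->
      \sum_(i < k) enorm (x (b i) - x (a i)) < e.

(* Caratheodory solution of x' = f(x, u), x(0) = x0, on [0, +oo[; the values
   of [u] and [x] at negative times are irrelevant, the derivative at the
   single point 0 being discarded by the "almost every" quantifier. *)
Definition solution (R : realType) (n m : nat)
    (f : 'rV[R]_n -> 'rV[R]_m -> 'rV[R]_n) (u : R -> 'rV[R]_m)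
    (x0 : 'rV[R]_n) (x : R -> 'rV[R]_n) : Prop :=
  [/\ x 0 = x0,
      forall T : R, 0 < T -> abs_continuous T x &
      {ae @lebesgue_measure R, forall t : R,
        0 <= t -> is_derive t 1 x (f (x t) (u t))}].

Definition admissible_input (R : realType) (m : nat) (u : R -> 'rV[R]_m) :
    Prop :=
  (forall i, measurable_fun `[0 : R, +oo[%classic (fun t : R => u t 0 i)) /\
  (forall T : R, exists M : R, forall t : R, 0 <= t <= T -> enorm (u t) <= M).

Definition steady_state_map (R : realType) (n m : nat)
    (f : 'rV[R]_n -> 'rV[R]_m -> 'rV[R]_n) (kx : 'rV[R]_m -> 'rV[R]_n) :
    Prop :=
  forall (ubar : 'rV[R]_m) (x0 : 'rV[R]_n),
    (exists x, solution f (fun=> ubar) x0 x) /\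
    (forall x, solution f (fun=> ubar) x0 x -> x t @[t --> +oo] --> kx ubar).

Definition nonneg_orthant (R : realType) (n : nat) : set 'rV[R]_n :=
  [set x | forall i, 0 <= x 0 i].

Definition geK (R : realType) (n : nat) (K : set 'rV[R]_n) (x y : 'rV[R]_n) :
    Prop :=
  K (x - y).

(* The first conjunct says that solutions are well defined on [0, +oo[ for
   all admissible inputs; their uniqueness is automatic for locally Lipschitz
   [f], and the second conjunct quantifies over all solutions anyway. *)
Definition monotone_system (R : realType) (n m p : nat)
    (KU : set 'rV[R]_m) (KX : set 'rV[R]_n) (KY : set 'rV[R]_p)
    (f : 'rV[R]_n -> 'rV[R]_m -> 'rV[R]_n) (g : 'rV[R]_n -> 'rV[R]_p) :
    Prop :=
  [/\ forall u x0, admissible_input u -> exists x, solution f u x0 x,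
      forall u u' x0 x0' x x',
        admissible_input u -> admissible_input u' ->
        {ae @lebesgue_measure R, forall t : R,
          0 <= t -> geK KU (u t) (u' t)} ->
        geK KX x0 x0' ->
        solution f u x0 x -> solution f u' x0' x' ->
        forall t : R, 0 <= t -> geK KX (x t) (x' t) &
      forall x x', geK KX x x' -> geK KY (g x) (g x')].

Definition box (R : realType) (m : nat) (umin umax : 'rV[R]_m) :
    set 'rV[R]_m :=
  [set u | forall i, umin 0 i <= u 0 i <= umax 0 i].

Definition strongly_convex (R : realType) (m : nat) (mu : R)
    (h : 'rV[R]_m -> R) : Prop :=
  forall (x y : 'rV[R]_m) (t : R), 0 <= t <= 1 ->
    h (t *: x + (1 - t) *: y) <=
      t * h x + (1 - t) * h y - mu / 2 * t * (1 - t) * enorm (x - y) ^+ 2.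

Definition argmin (R : realType) (m : nat) (U : set 'rV[R]_m)
    (h : 'rV[R]_m -> R) : set 'rV[R]_m :=
  [set u | U u /\ forall v, U v -> h u <= h v].

Definition Psit (R : realType) (m p : nat) (Phiu : 'rV[R]_m -> R)
    (Phiy : 'rV[R]_p -> R) (ky : 'rV[R]_m -> 'rV[R]_p)
    (u ubar : 'rV[R]_m) : R :=
  Phiu u + dotv (ky u) (grad Phiy (ky ubar)).

(* The equality with a singleton expresses that each minimizer exists and is
   unique, so that the iteration is well defined. *)
Definition iteration (R : realType) (m : nat) (U : set 'rV[R]_m)
    (Psi : 'rV[R]_m -> 'rV[R]_m -> R) (u0 : 'rV[R]_m)
    (s : nat -> 'rV[R]_m) : Prop :=
  s 0%N = u0 /\
  forall j, argmin U (fun u => Psi u (s j)) = [set s j.+1].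

(* Main.v *)
Require Import Defs.
From HB Require Import structures.
From mathcomp Require Import all_boot all_order all_algebra.
From mathcomp Require Import all_classical all_reals all_analysis.
From mathcomp Require Import ring lra.

Set Implicit Arguments.
Unset Strict Implicit.
Unset Printing Implicit Defensive.

Import Order.TTheory GRing.Theory Num.Theory.
Import numFieldNormedType.Exports.

Local Open Scope classical_set_scope.
Local Open Scope ring_scope.

(** Write [F a] for the minimizer over the box [U] of the strongly convex
    function [Psi(., a)].  The iteration is [s (j + 1) = F (s j)], and the
    theorem holds because [F] contracts [U] in the Euclidean norm with factor
    [ell / mu < 1].

    For the contraction, let [u = F a] and [v = F b].  A minimizer of a
    [mu]-strongly convex function beats any other point of [U] by at least
    [mu / 2] times the squared distance to it ([strongly_convex_growth]).
    Adding this inequality for [Psi(., a)] at [v] to the one for [Psi(., b)]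
    at [u] bounds [mu |u - v|^2] by the increment from [u] to [v] of
    [Psi(., a) - Psi(., b)].  The gradient of this difference has norm at most
    [ell |a - b|] on [U], and the segment from [u] to [v] stays in [U], so the
    mean value theorem ([mean_value_enorm]) bounds the increment by
    [ell |a - b| |u - v|].  Dividing by [|u - v|] gives the contraction
    ([argmin_lipschitz]).

    Because [U] is compact, the fixed point comes from minimizing the continuous
    function [x |-> |F x - x|]: if the minimum were positive, applying [F] to a
    minimizer would decrease it ([compact_contraction_fixpoint]).  Every orbit
    then converges geometrically to that fixed point
    ([contraction_orbit_cvg]).

    Compactness is also what makes each minimizer exist, once
    [Psi(., a)] is known to be continuous; it is even differentiable, since
    [Phiu] is, up to a constant, the restriction of [Phi] to [y = 0]
    ([Psit_differentiable]).  Uniqueness of the limit point follows by running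
    the iteration from it: two candidates would be limits of one sequence. *)

(** * Euclidean norm *)

Lemma enormE (R : realType) (n : nat) (x : 'rV[R]_n) :
  enorm x = Num.sqrt (dotv x x).
Proof. by rewrite /enorm /dotv big_ord1. Qed.

Lemma dotv_ge0 (R : realType) (n : nat) (x : 'rV[R]_n) : 0 <= dotv x x.
Proof. by apply: sumr_ge0 => i _; rewrite -expr2 sqr_ge0. Qed.

Lemma sqr_enorm (R : realType) (n : nat) (x : 'rV[R]_n) :
  enorm x ^+ 2 = dotv x x.
Proof. by rewrite enormE sqr_sqrtr // dotv_ge0. Qed.

Lemma enorm_ge0 (R : realType) (n : nat) (x : 'rV[R]_n) : 0 <= enorm x.
Proof. exact: sqrtr_ge0. Qed.

Lemma normr_coord_le_enorm (R : realType) (n : nat) (x : 'rV[R]_n) i :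
  `|x 0 i| <= enorm x.
Proof.
rewrite -ler_sqr ?nnegrE ?enorm_ge0 // sqr_enorm real_normK ?num_real //.
rewrite /dotv (bigD1 i) //= expr2 lerDl.
by apply: sumr_ge0 => j _; rewrite -expr2 sqr_ge0.
Qed.

Lemma enorm0 (R : realType) (n : nat) : enorm (0 : 'rV[R]_n) = 0.
Proof.
by rewrite enormE /dotv big1 ?sqrtr0 // => i _; rewrite mxE mul0r.
Qed.

Lemma enorm_eq0 (R : realType) (n : nat) (x : 'rV[R]_n) :
  enorm x = 0 -> x = 0.
Proof.
move=> x0; apply/rowP => i; rewrite mxE; apply/eqP.
by rewrite -normr_le0 -x0 normr_coord_le_enorm.
Qed.

Lemma enormBC (R : realType) (n : nat) (x y : 'rV[R]_n) :
  enorm (x - y) = enorm (y - x).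
Proof.
rewrite !enormE; congr Num.sqrt; apply: eq_bigr => i _.
by rewrite !mxE -mulrNN !opprB.
Qed.

(** Cauchy-Schwarz, by expanding the square of [|y| x - |x| y]. *)
Lemma dotv_le_enorm (R : realType) (n : nat) (x y : 'rV[R]_n) :
  dotv x y <= enorm x * enorm y.
Proof.
have dot0 (z t : 'rV[R]_n) : z = 0 \/ t = 0 -> dotv z t = 0.
  by case=> ->; rewrite /dotv big1 // => i _; rewrite mxE ?mul0r ?mulr0.
have [x0|xn0] := eqVneq (enorm x) 0.
  by rewrite dot0 ?x0 ?mul0r //; left; apply: enorm_eq0.
have [y0|yn0] := eqVneq (enorm y) 0.
  by rewrite dot0 ?y0 ?mulr0 //; right; apply: enorm_eq0.
have xy_gt0 : 0 < enorm x * enorm y.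
  by rewrite mulr_gt0 // lt_def ?xn0 ?yn0 enorm_ge0.
have := dotv_ge0 (enorm y *: x - enorm x *: y).
have -> : dotv (enorm y *: x - enorm x *: y) (enorm y *: x - enorm x *: y) =
    2 * (enorm x * enorm y) * (enorm x * enorm y - dotv x y).
  rewrite mulrBr.
  have -> : 2 * (enorm x * enorm y) * (enorm x * enorm y) =
      enorm y ^+ 2 * dotv x x + enorm x ^+ 2 * dotv y y.
    by rewrite -!sqr_enorm; ring.
  rewrite /dotv !mulr_sumr -big_split -sumrB /=.
  by apply: eq_bigr => i _; rewrite !mxE; ring.
by rewrite pmulr_rge0 ?subr_ge0 // mulr_gt0.
Qed.

(** This transfers Euclidean estimates to the topology, which is defined by the
    max norm. *)
Lemma mx_norm_le_enorm (R : realType) (n : nat) (x : 'rV[R]_n) :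
  `|x| <= enorm x.
Proof.
have [->|x0] := eqVneq `|x| 0; first exact: enorm_ge0.
have [[i j] xij] := mx_norm_neq0 x0.
by rewrite [leLHS]xij ord1 normr_coord_le_enorm.
Qed.

Lemma enorm_continuous (R : realType) (n : nat) :
  continuous (@enorm R 1 n).
Proof.
have -> : @enorm R 1 n = Num.sqrt \o (fun x => \sum_(j < n) x 0 j ^+ 2).
  by apply/funext => x; rewrite /enorm big_ord1.
move=> x; apply: continuous_comp; last exact: sqrt_continuous.
apply: (@continuous_big _ _ _ _ _ add_continuous) => j _ y.
apply: (@continuous_comp _ _ _ (fun z : 'rV[R]_n => z 0 j) (fun r => r ^+ 2)).
  exact: coord_continuous.
exact: exprn_continuous.
Qed.

Lemma enormB_continuous (R : realType) (n : nat) (a : 'rV[R]_n) :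
  continuous (fun x : 'rV[R]_n => enorm (x - a)).
Proof.
move=> x; apply: (@continuous_comp _ _ _ (fun y : 'rV[R]_n => y - a)).
  apply: (@continuousB _ _ _ id (cst a)); first exact: cvg_id.
  exact: cst_continuous.
exact: enorm_continuous.
Qed.

(** * Gradients and the mean value inequality *)

Lemma derive_dotv_grad (R : realType) (n : nat) (h : 'rV[R]_n -> R) x w :
  differentiable h x -> 'D_w h x = dotv (grad h x) w.
Proof.
move=> dh; rewrite deriveE // [in LHS](row_sum_delta w) linear_sum.
apply: eq_bigr => i _; rewrite linearZ /= !mxE deriveE // mulrC.
by [].
Qed.

Lemma is_derive_line (R : realType) (n : nat) (h : 'rV[R]_n -> R)
    (u w : 'rV[R]_n) t :
  differentiable h (t *: w + u) ->
  is_derive t (1 : R) (fun s : R => h (s *: w + u)) ('D_w h (t *: w + u)).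
Proof.
move=> dh.
(* both derivatives are limits of the same difference quotient *)
have E : (fun s : R => s^-1 *: (h ((s *: 1 + t) *: w + u) - h (t *: w + u))) =
  (fun s => s^-1 *: (h (s *: w + (t *: w + u)) - h (t *: w + u))).
  by apply/funext => s; rewrite scalerDl -addrA -[s *: 1]/(s * 1) mulr1.
have := diff_derivable (v := w) dh.
by split; rewrite /derivable /derive /= E.
Qed.

(** The mean value theorem on the segment from [u] to [v], followed by
    Cauchy-Schwarz; the gradient only has to be bounded on that segment. *)
Lemma mean_value_enorm (R : realType) (n : nat) (h : 'rV[R]_n -> R) u v L :
  (forall x, differentiable h x) ->
  (forall t, 0 <= t <= 1 -> enorm (grad h (t *: v + (1 - t) *: u)) <= L) ->
  h v - h u <= L * enorm (v - u).
Proof.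
move=> dh hL; set w := v - u.
have dphi t :
    is_derive t (1 : R) (fun s : R => h (s *: w + u)) ('D_w h (t *: w + u)).
  exact: is_derive_line.
have [|c] := @MVT_segment _ _ _ 0 1 ler01 (fun x _ => dphi x).
  apply: derivable_within_continuous => t _; exact: @ex_derive.
rewrite in_itv /= => c01; rewrite scale1r scale0r add0r subrK subr0 mulr1 => ->.
rewrite derive_dotv_grad //; apply: le_trans (dotv_le_enorm _ _) _.
apply: ler_wpM2r; first exact: enorm_ge0.
have -> : c *: w + u = c *: v + (1 - c) *: u.
  by rewrite /w scalerBr scalerBl scale1r -addrA (addrC _ u).
exact: hL.
Qed.

(** * Minimizers of strongly convex functions *)

Definition convex_subset (R : realType) (m : nat) (U : set 'rV[R]_m) : Prop :=
  forall x y t, U x -> U y -> 0 <= t <= 1 -> U (t *: x + (1 - t) *: y).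

(** Comparing [h u] with the value at [t v + (1 - t) u] and dividing by [t]
    gives [(1 - t) (mu / 2) |u - v|^2 <= h v - h u] for [0 < t <= 1]; the claim
    is the limit [t -> 0].  The factor [1 / 2] disappears in
    [argmin_lipschitz], where two such inequalities are added. *)
Lemma strongly_convex_growth (R : realType) (m : nat) (mu : R)
    (U : set 'rV[R]_m) (h : 'rV[R]_m -> R) u v :
  convex_subset U -> strongly_convex mu h -> argmin U h u -> U v ->
  mu / 2 * enorm (u - v) ^+ 2 <= h v - h u.
Proof.
move=> Uconv hconv [Uu umin] Uv; set c := mu / 2 * _; set d := h v - h u.
have d_ge0 : 0 <= d by rewrite subr_ge0 umin.
have dP t : 0 < t -> t <= 1 -> (1 - t) * c <= d.
  move=> t0 t1.
  have t01 : 0 <= t <= 1 by rewrite (ltW t0) t1.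
  have := le_trans (umin _ (Uconv _ _ _ Uv Uu t01)) (hconv v u t t01).
  rewrite (enormBC v u) -subr_ge0.
  rewrite (_ : _ - _ = t * (d - (1 - t) * c)); last by rewrite /d /c; ring.
  by rewrite pmulr_rge0 // subr_ge0.
rewrite leNgt; apply/negP => dc.
have c0 : 0 < c by exact: le_lt_trans dc.
(* [dP] fails for every positive t below (c - d) / c: take half that bound *)
clearbody c d; have := dP ((c - d) / (2 * c)).
rewrite divr_gt0 ?subr_gt0 ?mulr_gt0 // => /(_ isT).
rewrite ler_pdivrMr ?mulr_gt0 // mul1r => H.
have : c - d <= 2 * c by lra.
move=> /H; rewrite mulrBl mul1r.
rewrite (_ : (c - d) / (2 * c) * c = (c - d) / 2); last first.
  by field; rewrite gt_eqF.
by lra.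
Qed.

(** Compactness gives existence, quadratic growth gives uniqueness. *)
Lemma argmin_set1 (R : realType) (m : nat) (mu : R)
    (U : set 'rV[R]_m) (h : 'rV[R]_m -> R) :
  0 < mu -> U !=set0 -> compact U -> convex_subset U ->
  continuous h -> strongly_convex mu h ->
  exists u, argmin U h = [set u].
Proof.
move=> mu0 Un0 Uc Uconv hc hconv.
have [u /set_mem Uu umin] := EVT_min_rV Un0 Uc (continuous_subspaceT hc).
have uA : argmin U h u by split => // v Uv; apply: umin; exact/mem_set.
exists u; apply/seteqP; split => [v [Uv vmin]|v -> //] /=.
have : mu / 2 * enorm (u - v) ^+ 2 <= 0.
  apply: le_trans (strongly_convex_growth Uconv hconv uA Uv) _.
  by rewrite subr_le0 vmin.
rewrite pmulr_rle0 ?divr_gt0 // => e0; apply/esym/eqP; rewrite -subr_eq0.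
apply/eqP/enorm_eq0/eqP; rewrite -(@sqrf_eq0 _ (enorm _)).
by rewrite eq_le e0 sqr_ge0.
Qed.

(** Stability of minimizers: each of [u] and [v] is suboptimal for the other
    function by [mu / 2 |u - v|^2] at least, so [h1 - h2] increases from [u] to
    [v] by [mu |u - v|^2] at least; the gradient bound allows an increase of
    at most [L |u - v|]. *)
Lemma argmin_lipschitz (R : realType) (m : nat) (mu L : R)
    (U : set 'rV[R]_m) (h1 h2 : 'rV[R]_m -> R) u v :
  convex_subset U ->
  strongly_convex mu h1 -> strongly_convex mu h2 ->
  (forall x, differentiable h1 x) -> (forall x, differentiable h2 x) ->
  (forall x, U x -> enorm (grad h1 x - grad h2 x) <= L) ->
  argmin U h1 u -> argmin U h2 v ->
  mu * enorm (u - v) <= L.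
Proof.
move=> Uconv cv1 cv2 d1 d2 gL u1 v2.
have [Uu _] := u1; have [Uv _] := v2.
have dD x : differentiable (h1 - h2) x by exact: differentiableB.
have gD x : grad (h1 - h2) x = grad h1 x - grad h2 x.
  by apply/rowP => i; rewrite !mxE deriveB //; exact: diff_derivable.
have mv : (h1 - h2) v - (h1 - h2) u <= L * enorm (v - u).
  by apply: mean_value_enorm => // t t01; rewrite gD; apply/gL/Uconv.
have := strongly_convex_growth Uconv cv1 u1 Uv.
have := strongly_convex_growth Uconv cv2 v2 Uu.
rewrite (enormBC v u) in mv *.
have [e0|en0] := eqVneq (enorm (u - v)) 0.
  move=> _ _; rewrite e0 mulr0.
  exact: le_trans (enorm_ge0 _) (gL _ Uu).
have e0 : 0 < enorm (u - v) by rewrite lt_def en0 enorm_ge0.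
move=> g1 g2; rewrite -(ler_pM2r e0); apply: le_trans mv.
rewrite (_ : (h1 - h2) v - (h1 - h2) u = (h1 v - h1 u) + (h2 u - h2 v)).
  apply: le_trans (lerD g2 g1); rewrite le_eqVlt; apply/orP; left; apply/eqP.
  by field.
by rewrite !fctE; ring.
Qed.

(** * Contractions of a compact set *)

(** Compactness replaces completeness: a minimizer [x] of [|F x - x|] is fixed,
    as otherwise [F x] would do strictly better.  Banach's theorem in
    the max norm would not apply: [F] contracts Euclidean distances only. *)
Lemma compact_contraction_fixpoint (R : realType) (m : nat) (q : R)
    (U : set 'rV[R]_m) (F : 'rV[R]_m -> 'rV[R]_m) :
  q < 1 -> U !=set0 -> compact U -> (forall x, U x -> U (F x)) ->
  (forall x y, U x -> U y -> enorm (F x - F y) <= q * enorm (x - y)) ->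
  exists2 x, U x & F x = x.
Proof.
move=> q1 Un0 Uc FU Fq.
have Fc : {within U, continuous F}.
  apply/subspace_continuousP => x Ux; apply/cvgrPdist_lt => e e0.
  have : \forall y \near x, enorm (y - x) < e.
    have /cvgr_lt := @enormB_continuous R m x x.
    by apply; rewrite subrr enorm0.
  rewrite near_withinE; apply: filterS => y ye Uy.
  apply: le_lt_trans (mx_norm_le_enorm _) _.
  apply: le_lt_trans (Fq _ _ Ux Uy) _; rewrite enormBC.
  apply: le_lt_trans ye; rewrite -[leRHS]mul1r.
  by apply: ler_wpM2r; [exact: enorm_ge0 | exact: ltW].
have phic : {within U, continuous (fun x => enorm (F x - x))}.
  move=> x.
  apply: (@continuous_comp _ _ _ (fun x : subspace U => F x - x : 'rV[R]_m)).
    apply: (@continuousB _ _ (subspace U) F id); first exact: Fc.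
    by apply: continuous_subspaceT => y; exact: cvg_id.
  exact: enorm_continuous.
have [x /set_mem Ux xmin] := EVT_min_rV Un0 Uc phic.
exists x => //; apply/eqP; rewrite -subr_eq0; apply/eqP/enorm_eq0.
apply/eqP; rewrite eq_le enorm_ge0 andbT leNgt; apply/negP => e0.
have := le_trans (xmin _ (mem_set (FU _ Ux))) (Fq _ _ (FU _ Ux) Ux).
by rewrite leNgt -[X in _ < X]mul1r ltr_pM2r // q1.
Qed.

Lemma contraction_orbit_cvg (R : realType) (m : nat) (q : R)
    (U : set 'rV[R]_m) (F : 'rV[R]_m -> 'rV[R]_m) x (s : nat -> 'rV[R]_m) :
  0 <= q -> q < 1 -> (forall x, U x -> U (F x)) ->
  (forall x y, U x -> U y -> enorm (F x - F y) <= q * enorm (x - y)) ->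
  U x -> F x = x -> U (s 0%N) -> (forall j, s j.+1 = F (s j)) ->
  s j @[j --> \oo] --> x.
Proof.
move=> q0 q1 FU Fq Ux Fx Us0 sS.
have Us j : U (s j) by elim: j => // j IHj; rewrite sS; exact: FU.
have sq j : enorm (s j - x) <= geometric (enorm (s 0%N - x)) q j.
  elim: j => [|j IHj] /=; first by rewrite expr0 mulr1.
  rewrite sS -[X in F _ - X]Fx; apply: le_trans (Fq _ _ (Us j) Ux) _.
  by rewrite exprS mulrCA; apply: ler_wpM2l.
apply/cvgrPdist_lt => e e0.
have : `|q| < 1 by rewrite ger0_norm.
move/(cvg_geometric (enorm (s 0%N - x))) => /cvgr_lt /(_ _ e0).
apply: filterS => j; apply: le_lt_trans.
by rewrite distrC; apply: le_trans (mx_norm_le_enorm _) (sq j).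
Qed.

(** * The box and the objective *)

Lemma box_compact (R : realType) (m : nat) (umin umax : 'rV[R]_m) :
  compact (box umin umax).
Proof.
exact: (@rV_compact R m (fun i => `[umin 0 i, umax 0 i]%classic)
  (fun i => @segment_compact R _ _)).
Qed.

Lemma box_convex (R : realType) (m : nat) (umin umax : 'rV[R]_m) :
  convex_subset (box umin umax).
Proof.
move=> x y t xU yU /andP[t0 t1] i; rewrite !mxE.
have /andP[x1 x2] := xU i; have /andP[y1 y2] := yU i.
by apply/andP; split; nra.
Qed.

Lemma row_mx0_differentiable (R : realType) (m p : nat) (u : 'rV[R]_m) :
  differentiable (fun v : 'rV[R]_m => row_mx v (0 : 'rV[R]_p)) u.
Proof.
have lin : linear (fun v : 'rV[R]_m => row_mx v (0 : 'rV[R]_p)).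
  by move=> a v w; rewrite scale_row_mx add_row_mx scaler0 addr0.
pose linM := GRing.isLinear.Build _ _ _ _ _ lin.
pose L : {linear _ -> _} :=
  HB.pack (fun v : 'rV[R]_m => row_mx v (0 : 'rV[R]_p)) linM.
apply: (@linear_differentiable _ _ _ L).
move=> v A /nbhs_ballP[e /= e0 eA].
apply/nbhs_ballP; exists e => //= w [_ vw]; apply: eA; split => // i j.
rewrite !mxE; case: splitP => k _; first exact: vw.
by rewrite mxE; apply: ballxx.
Qed.

(** Differentiability of [Phiu] is inherited from [Phi] through
    [Phiu v = Phi v 0 - Phiy 0].  In the other summand [grad Phiy (ky ubar)] is
    a constant vector. *)
Lemma Psit_differentiable (R : realType) (m p : nat)
    (Phi : 'rV[R]_m -> 'rV[R]_p -> R)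
    (Phiu : 'rV[R]_m -> R) (Phiy : 'rV[R]_p -> R) (ky : 'rV[R]_m -> 'rV[R]_p)
    (ubar u : 'rV[R]_m) :
  (forall u y, Phi u y = Phiu u + Phiy y) ->
  (forall z, differentiable (joint Phi) z) ->
  (forall v, differentiable ky v) ->
  differentiable (fun v => Psit Phiu Phiy ky v ubar) u.
Proof.
move=> PhiE dPhi dky; apply: differentiableD.
  have -> : Phiu = (joint Phi \o (fun v => row_mx v 0)) - cst (Phiy 0).
    apply/funext => v; rewrite /GRing.add /= /GRing.opp /= /joint.
    by rewrite row_mxKl row_mxKr PhiE addrK.
  apply: differentiableB => //.
  by apply: differentiable_comp => //; exact: row_mx0_differentiable.
rewrite /dotv; set w := grad _ _.
have -> : (fun v => \sum_i ky v 0 i * w 0 i) =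
    \sum_i ((fun v => ky v 0 i) * cst (w 0 i)).
  by apply/funext => v; rewrite fct_sumE.
apply: differentiable_sum => i; apply: differentiableM => //.
exact: (@differentiable_comp _ _ _ _ ky (fun y : 'rV[R]_p => y 0 i)
  u (dky u) (differentiable_coord _ _ _)).
Qed.

(** * Convergence of the iteration *)

Theorem lemma4 (R : realType) (n m p : nat)
  (f : 'rV[R]_n -> 'rV[R]_m -> 'rV[R]_n) (g : 'rV[R]_n -> 'rV[R]_p)
  (kx : 'rV[R]_m -> 'rV[R]_n) (ky : 'rV[R]_m -> 'rV[R]_p)
  (Phi : 'rV[R]_m -> 'rV[R]_p -> R)
  (Phiu : 'rV[R]_m -> R) (Phiy : 'rV[R]_p -> R)
  (umin umax : 'rV[R]_m) (mu ell : R)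
  (* plant assumption *)
  (f_lip : locally_lipschitz (joint f))
  (g_lip : locally_lipschitz g)
  (kx_cont : continuous kx)
  (kx_steady : steady_state_map f kx)
  (ky_def : ky = g \o kx)
  (ky_C1 : C1_vector ky)
  (Jky_lip : locally_lipschitz (Jac ky))
  (* cost assumption *)
  (Phi_split : forall u y, Phi u y = Phiu u + Phiy y)
  (Phi_C1 : C1_scalar (joint Phi))
  (gradPhi_lip : locally_lipschitz (grad (joint Phi)))
  (box_nonempty : forall i, umin 0 i <= umax 0 i)
  (* monotonicity with respect to the standard orders *)
  (fg_monotone : monotone_system (@nonneg_orthant R m) (@nonneg_orthant R n)
                   (@nonneg_orthant R p) f g)
  (* strong convexity and Lipschitz constants *)
  (ell_ge0 : 0 <= ell) (ell_lt_mu : ell < mu)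
  (Psi_convex : forall ubar, box umin umax ubar ->
     strongly_convex mu (fun u => Psit Phiu Phiy ky u ubar))
  (gradPsi_lip : forall u, box umin umax u ->
     forall ubar ubar', box umin umax ubar -> box umin umax ubar' ->
     enorm (grad (fun v => Psit Phiu Phiy ky v ubar) u -
            grad (fun v => Psit Phiu Phiy ky v ubar') u)
       <= ell * enorm (ubar - ubar')) :
  exists! ustar : 'rV[R]_m,
    box umin umax ustar /\
    forall u0 : 'rV[R]_m, box umin umax u0 ->
      (exists s, iteration (box umin umax) (Psit Phiu Phiy ky) u0 s) /\
      (forall s, iteration (box umin umax) (Psit Phiu Phiy ky) u0 s ->
         s j @[j --> \oo] --> ustar).
Proof.
set U := box umin umax; set Psi := Psit Phiu Phiy ky.
have mu0 : 0 < mu by exact: le_lt_trans ell_lt_mu.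
have [dky _] := ky_C1; have [dPhi _] := Phi_C1.
have Uc : compact U by exact: box_compact.
have Un0 : U !=set0 by exists umin => i; rewrite lexx box_nonempty.
have Uconv : convex_subset U by exact: box_convex.
have dPsi a u : differentiable (fun v => Psi v a) u.
  exact: Psit_differentiable Phi_split dPhi dky.
(* 0 is a placeholder value of F outside U, which orbits never leave *)
have [F FE] : {F : 'rV[R]_m -> 'rV[R]_m &
    forall a, U a -> argmin U (fun u => Psi u a) = [set F a]}.
  apply: (@choice _ _
    (fun a b => U a -> argmin U (fun u => Psi u a) = [set b])).
  move=> a; have [Ua|nUa] := pselect (U a); last by exists 0.
  have [b bE] := argmin_set1 mu0 Un0 Uc Uconv
    (fun u => differentiable_continuous (dPsi a u)) (Psi_convex a Ua).
  by exists b.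
have Fmin a : U a -> argmin U (fun u => Psi u a) (F a).
  by move=> Ua; rewrite FE.
have FU a : U a -> U (F a) by move=> /Fmin[].
have Fq a b : U a -> U b -> enorm (F a - F b) <= ell / mu * enorm (a - b).
  move=> Ua Ub; rewrite mulrAC ler_pdivlMr // mulrC.
  apply: (argmin_lipschitz Uconv (Psi_convex a Ua) (Psi_convex b Ub)
    (dPsi a) (dPsi b) _ (Fmin a Ua) (Fmin b Ub)).
  by move=> x Ux; exact: gradPsi_lip.
have q0 : 0 <= ell / mu by rewrite divr_ge0 // ltW.
have q1 : ell / mu < 1 by rewrite ltr_pdivrMr // mul1r.
have [ustar Ustar Fstar] := compact_contraction_fixpoint q1 Un0 Uc FU Fq.
have iter_ex u0 : U u0 -> exists s, iteration U Psi u0 s.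
  move=> Uu0; exists (fun j => iter j F u0); split => // j; rewrite FE //.
  by elim: j => // j; exact: FU.
have iter_cvg u0 s : U u0 -> iteration U Psi u0 s -> s j @[j --> \oo] --> ustar.
  move=> Uu0 [s0 sS].
  have Us j : U (s j).
    elim: j => [|j IHj]; first by rewrite s0.
    by have [] : argmin U (fun u => Psi u (s j)) (s j.+1) by rewrite sS.
  apply: (contraction_orbit_cvg q0 q1 FU Fq Ustar Fstar (Us 0%N)) => j.
  have : [set s j.+1] (F (s j)) by rewrite -sS; exact: Fmin.
  by move=> /= ->.
exists ustar; split.
  by split=> // u0 Uu0; split=> [|s]; [exact: iter_ex | exact: iter_cvg].
(* the orbit that starts at ustar also has to converge to u' *)
move=> u' [_ u'P]; have [s sP] := iter_ex _ Ustar.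
have [_ /(_ _ sP) su'] := u'P _ Ustar.
exact: cvg_unique (iter_cvg _ _ Ustar sP) su'.
Qed.
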